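(* There is $n_0\in\mathbb{N}$ such that for any $n\geq n_0$ and any connected graph $H$ on $n$ vertices, $f(H)>n$, i.e., Painter loses the online Ramsey turnaround game for $H$ on $n$ vertices.
   Context: The online Ramsey turnaround game for a graph $H$ on $n$ vertices, with colors red, green, blue, is played by Builder and Painter. In each round Builder exposes one new (previously unexposed) edge on a fixed set of $n$ vertices and may forbid one of the three colors for this edge; Painter then immediately colors this edge with a color that is not forbidden. Painter wins as soon as there is a monochromatic copy of $H$; Builder wins (Painter loses) if all $\binom n2$ edges have been exposed without a monochromatic copy of $H$. $f(H)$ is the smallest $n$ such that Painter has a winning strategy in this game for $H$ on $n$ vertices. *)

(* Defs.v *)
From mathcomp Require Import all_boot.
From mathcomp Require Import boolp.
Set Implicit Arguments.
Unset Strict Implicit.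
Unset Printing Implicit Defensive.

Record sgraph := SGraph {
  vertex :> finType;
  adj : rel vertex;
  adj_sym : symmetric adj;
  adj_irrefl : irreflexive adj }.

Definition connected_graph (H : sgraph) : Prop :=
  0 < #|H| /\ forall x y : H, connect (@adj H) x y.

Definition color := 'I_3.

(* One round on the board with vertex set 'I_n: the exposed edge, the color
   forbidden by Builder ([None] when no color is forbidden), and the color
   chosen by Painter. *)
Record round (n : nat) := Round {
  edge : {set 'I_n};
  forbidden : option color;
  paint : color }.

Definition exposed n (p : seq (round n)) : seq {set 'I_n} := map (@edge n) p.

(* Plays list their rounds in chronological order. *)
Definition legal_play n (p : seq (round n)) : bool :=
  uniq (exposed p) &&
  all (fun r => (#|edge r| == 2) && (forbidden r != Some (paint r))) p.

Definition complete_play n (p : seq (round n)) : bool :=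
  [forall e : {set 'I_n}, (#|e| == 2) ==> (e \in exposed p)].

(* Copies are not required to be induced. *)
Definition mono_copy (H : sgraph) n (p : seq (round n)) : Prop :=
  exists (c : color) (phi : H -> 'I_n), injective phi /\
    forall x y : H, adj x y ->
      ([set phi x; phi y], c) \in [seq (edge r, paint r) | r <- p].

Definition painter_strategy n :=
  seq (round n) -> {set 'I_n} -> option color -> color.

Definition builder_strategy n := seq (round n) -> {set 'I_n} * option color.

Definition legal_painter n (tau : painter_strategy n) : Prop :=
  forall h e o, o != Some (tau h e o).

Definition legal_builder n (sigma : builder_strategy n) : Prop :=
  forall h, legal_play h -> ~~ complete_play h ->
    #|(sigma h).1| = 2 /\ (sigma h).1 \notin exposed h.

Definition follows_painter n (tau : painter_strategy n) (p : seq (round n)) :=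
  forall h r t, p = h ++ r :: t -> paint r = tau h (edge r) (forbidden r).

Definition follows_builder n (sigma : builder_strategy n)
    (p : seq (round n)) :=
  forall h r t, p = h ++ r :: t -> (edge r, forbidden r) = sigma h.

(* A monochromatic copy persists once it has appeared, so stopping at the first
   copy or exposing all remaining edges gives the same winner; plays are
   therefore judged when every edge has been exposed. *)
Definition painter_wins (H : sgraph) (n : nat) : Prop :=
  exists tau : painter_strategy n, legal_painter tau /\
    forall p, legal_play p -> complete_play p -> follows_painter tau p ->
      mono_copy H p.

Definition builder_wins (H : sgraph) (n : nat) : Prop :=
  exists sigma : builder_strategy n, legal_builder sigma /\
    forall p, legal_play p -> complete_play p -> follows_builder sigma p ->
      ~ mono_copy H p.

Lemma color_pigeonhole (T : finType) (f : T -> color) (A : {set T}) m :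
  3 * m < #|A| + 3 -> exists d, m <= #|[set x in A | f x == d]|.
Proof.
move=> hA; apply/existsP; apply: contraLR hA.
rewrite negb_exists => /forallP hd; rewrite -leqNgt.
have hm j : \sum_(d : color) j = 3 * j by rewrite sum_nat_const card_ord.
rewrite -(hm m) -[X in _ + X]muln1 -(hm 1) -sum1_card.
rewrite (partition_big f predT) //= -big_split /=; apply: leq_sum => d _.
have := hd d; rewrite -ltnNge addn1; congr (_ < _).
by rewrite -sum1_card; apply: eq_bigl => x; rewrite inE.
Qed.

Lemma ramsey_chain (V : finType) (c : V -> V -> color) m (A : {set V}) :
  3 ^ m <= #|A| ->
  exists s : seq (V * color),
    [/\ size s = m, uniq (map fst s), {subset map fst s <= A}
      & pairwise (fun u v => c u.1 v.1 == u.2) s].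
Proof.
elim: m A => [|m IH] A hA; first by exists [::].
have /card_gt0P[x xA] : 0 < #|A| by apply: leq_trans hA; rewrite expn_gt0.
have [|d /IH[s [ss us sA ps]]] :=
    @color_pigeonhole V (c x) (A :\ x) (3 ^ m).
  rewrite -expnS; apply: leq_ltn_trans hA _.
  by rewrite (cardsD1 x A) xA addnC ltn_add2l.
exists ((x, d) :: s); split => //=.
- by rewrite ss.
- by rewrite us andbT; apply/negP => /sA; rewrite !inE eqxx.
- by move=> y; rewrite inE => /orP[/eqP->//|/sA]; rewrite !inE => /andP[/andP[]].
- rewrite ps andbT; apply/allP => v vs /=.
  by have := sA _ (map_f fst vs); rewrite inE => /andP[].
Qed.

Lemma ramsey3 (V : finType) (c : V -> V -> color) k :
  (forall x y, c x y = c y x) -> 3 ^ (3 * k) <= #|V| ->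
  exists (d : color) (t : seq V), [/\ k <= size t, uniq t
    & {in t &, forall x y, x != y -> c x y = d}].
Proof.
move=> csym; rewrite -cardsT => /(ramsey_chain c)[s [ss us _ ps]].
have [|d hd] := @color_pigeonhole 'I_(size s) (fun i => (tnth (in_tuple s) i).2)
    setT k.
  by rewrite cardsT card_ord ss -[X in X < _]addn0 ltn_add2l.
pose s' := [seq u <- s | u.2 == d].
have hs' : k <= size s'.
  apply: leq_trans hd _; rewrite size_filter.
  rewrite -sum1_card -sum1_count [X in _ <= X](big_tnth) /=.
  by apply/eq_leq/eq_bigl => i; rewrite !inE.
have : pairwise (fun x y => c x y == d) (map fst s').
  rewrite pairwise_map; have := pairwise_filter (fun u => u.2 == d) ps.
  apply: (sub_in_pairwise (P := [pred u | u.2 == d])).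
    by move=> u v /= /eqP <-.
  exact: filter_all.
have us' : uniq (map fst s').
  exact: subseq_uniq (map_subseq _ (filter_subseq _ _)) us.
move=> pt; exists d, (map fst s'); split=> //; first by rewrite size_map.
move: (map fst s') pt {us' hs'}; elim=> //= z t IH /andP[/allP hz /IH{}IH] x y.
rewrite !inE => /orP[/eqP->|xt] /orP[/eqP->|yt] xy; last exact: IH.
- by rewrite eqxx in xy.
- exact/eqP/hz.
- by rewrite csym; exact/eqP/hz.
Qed.

Lemma painter_wins_exists (H : sgraph) : exists n, painter_wins H n.
Proof.
exists (3 ^ (3 * #|H|)).
set n := 3 ^ _; have n_gt0 : 0 < n by rewrite expn_gt0.
pose other (o : option color) : color :=
  if o == Some ord0 then ord_max else ord0.
exists (fun _ _ o => other o); split.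
  by move=> _ _ o; rewrite /other; case: ifP => [/eqP->|->].
move=> p lp /forallP cp _.
pose r0 : round n := Round set0 None ord0.
pose c (x y : 'I_n) : color :=
  paint (nth r0 p (index [set x; y] (exposed p))).
have [||d [t [kt ut ct]]] := @ramsey3 _ c #|H|.
- by move=> x y; rewrite /c setUC.
- by rewrite card_ord.
pose phi (x : H) := nth (Ordinal n_gt0) t (enum_rank x).
have lt_t (x : H) : enum_rank x < size t by apply: leq_trans kt.
have phi_inj : injective phi.
  move=> x y /eqP; rewrite nth_uniq // => /eqP/ord_inj; exact: enum_rank_inj.
exists d, phi; split=> // x y xy.
have phi_xy : phi x != phi y.
  by apply/eqP => /phi_inj exy; rewrite exy adj_irrefl in xy.
have hc : c (phi x) (phi y) = d by apply: ct; rewrite ?mem_nth.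
have he : [set phi x; phi y] \in exposed p.
  by apply: (implyP (cp _)); rewrite cards2 phi_xy.
rewrite -hc /c -{1}(nth_index set0 he).
have hi : index [set phi x; phi y] (exposed p) < size p.
  by rewrite -(size_map (@edge n)) index_mem.
rewrite /exposed (nth_map r0) //.
set i := index _ _; apply/(nthP (set0, ord0)); exists i.
  by rewrite size_map.
by rewrite (nth_map r0).
Qed.

Lemma painter_wins_existsb (H : sgraph) : exists n, `[< painter_wins H n >].
Proof. by have [n /asboolP] := painter_wins_exists H; exists n. Qed.

(* The number f(H): the least n for which Painter wins on n vertices. *)
Definition turnaround_number (H : sgraph) : nat :=
  ex_minn (painter_wins_existsb H).

(* Main.v *)
(* Every graph with n vertices falls under one of two strategies of Builder.

   If no two vertices of H cover all its edges, Builder starts with an edge vw,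
   forbidding red; say Painter answers c, and let d be the third color.  Then
   Builder forbids red at v, d on the other edges at w, and c elsewhere.  Now v
   is isolated in red, w is isolated in d, and v, w cover all edges of color c.

   If {a, b} covers the edges of H, connectedness makes every other vertex
   adjacent to a or b.  Builder forbids colors in a fixed pattern such that, for
   any vertices a, b and any color c, some third vertex z has c forbidden on both
   za and zb.  Such a pattern comes from a partition of Z/15 into three sets each
   of whose difference sets is the whole of Z/15, the edge ij being assigned the
   class of i + j. *)
Require Import Defs.
From HB Require Import structures.
From mathcomp Require Import all_boot.
From mathcomp Require Import boolp.
From mathcomp Require Import zify.

Set Implicit Arguments.
Unset Strict Implicit.
Unset Printing Implicit Defensive.

Definition tuple_of_round n (r : round n) := (edge r, forbidden r, paint r).

Definition round_of_tuple n (u : {set 'I_n} * option color * color) : round n :=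
  Round u.1.1 u.1.2 u.2.

Lemma tuple_of_roundK n : cancel (@tuple_of_round n) (@round_of_tuple n).
Proof. by case. Qed.

HB.instance Definition _ n :=
  Equality.copy (round n) (can_type (@tuple_of_roundK n)).

Definition coloring n (p : seq (round n)) : seq ({set 'I_n} * color) :=
  [seq (edge r, paint r) | r <- p].

Lemma coloring_fun n (p : seq (round n)) e c d :
  legal_play p -> (e, c) \in coloring p -> (e, d) \in coloring p -> c = d.
Proof.
case/andP; rewrite /exposed; elim: p => //= r p IH /andP[rp up] /andP[_ lp].
have notin f : (edge r, f) \notin coloring p.
  by apply: contra rp => /mapP[s sp [-> _]]; apply: map_f.
rewrite !inE !xpair_eqE; case: eqP => [->|_] /=; last exact: IH.
by rewrite !(negPf (notin _)) !orbF => /eqP-> /eqP.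
Qed.

Definition new_edge n (h : seq (round n)) : {set 'I_n} :=
  odflt set0 [pick e : {set 'I_n} | (#|e| == 2) && (e \notin exposed h)].

Lemma new_edgeP n (h : seq (round n)) : ~~ complete_play h ->
  #|new_edge h| = 2 /\ new_edge h \notin exposed h.
Proof.
rewrite /complete_play negb_forall => /existsP[e]; rewrite negb_imply => He.
by rewrite /new_edge; case: pickP => [f /andP[/eqP]//|/(_ e)]; rewrite He.
Qed.

Lemma follows_rcons n (p : seq (round n)) r (P : seq (round n) -> round n -> Prop) :
  (forall h s t, p = h ++ s :: t -> P h s) -> P p r ->
  forall h s t, rcons p r = h ++ s :: t -> P h s.
Proof.
move=> Pp Pr h s; case/lastP => [|t u].
  by rewrite cats1 => /rcons_inj[<- <-].
by rewrite -rcons_cons -rcons_cat => /rcons_inj[/Pp].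
Qed.

Lemma complete_play_exists n (sigma : builder_strategy n)
    (tau : painter_strategy n) :
  legal_builder sigma -> legal_painter tau ->
  exists p, [/\ legal_play p, complete_play p, follows_builder sigma p
              & follows_painter tau p].
Proof.
move=> lsigma ltau.
have play k : exists p, [/\ legal_play p, follows_builder sigma p,
    follows_painter tau p & complete_play p \/ size p = k].
  elim: k => [|k [p [lp bp pp]]].
    by exists [::]; split=> //; [case|case|right].
  case: (boolP (complete_play p)) => cp; first by exists p; split=> //; left.
  case=> // sp.
  have [e2 eN] := lsigma p lp cp.
  pose e := (sigma p).1; pose o := (sigma p).2.
  pose r := Round e o (tau p e o).
  exists (rcons p r); split.
  - case/andP: lp => up ap; rewrite /legal_play /exposed map_rcons rcons_uniq.
    by rewrite all_rcons eN up ap /= e2 eqxx ltau.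
  - by apply: follows_rcons => //=; rewrite /e /o; case: (sigma p).
  - exact: follows_rcons.
  - by right; rewrite size_rcons sp.
(* A play of this length would expose more distinct edges than there are sets of vertices. *)
have [p [lp bp pp [cp|sp]]] := play #|{set 'I_n}|.+1; first by exists p.
case/andP: lp => /card_uniqP up _; have := max_card [in exposed p].
by rewrite up size_map sp ltnn.
Qed.

(** Playing [tau] against any legal Builder strategy ends with a copy, which embeds [H] in the
    board. Hence only boards with exactly [#|H|] vertices remain to be excluded. *)
Lemma painter_wins_card (H : sgraph) n : painter_wins H n -> #|H| <= n.
Proof.
case=> tau [ltau win].
have lb : @legal_builder n (fun h => (new_edge h, None)).
  by move=> h _ /new_edgeP.
have [p [lp cp _ pp]] := complete_play_exists lb ltau.
have [_ [phi [phi_inj _]]] := win p lp cp pp.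
by have := leq_card phi phi_inj; rewrite card_ord.
Qed.

Lemma builder_wins_painter (H : sgraph) n : builder_wins H n -> ~ painter_wins H n.
Proof.
case=> sigma [lsigma bwin] [tau [ltau pwin]].
have [p [lp cp bp pp]] := complete_play_exists lsigma ltau.
exact: bwin p lp cp bp (pwin p lp cp pp).
Qed.

Lemma builder_wins_turnaround (H : sgraph) :
  builder_wins H #|H| -> #|H| < turnaround_number H.
Proof.
move=> bw; rewrite /turnaround_number; case: ex_minnP => m /asboolP pm _.
rewrite ltn_neqAle painter_wins_card // andbT; apply/eqP => Hm.
by rewrite -Hm in pm; apply: builder_wins_painter pm.
Qed.

(** Reduces the game to patterns of forbidden colors that depend only on Painter's answer [c] on the
    first edge [e0]. As [F c e0] is [f0] for every [c], Builder can forbid it before knowing [c],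
    and all edges then obey [F c]. *)
Lemma builder_wins_pattern (H : sgraph) n (e0 : {set 'I_n})
    (F : color -> {set 'I_n} -> color) f0 :
  #|e0| = 2 -> (forall c, F c e0 = f0) ->
  (forall (p : seq (round n)) c, legal_play p -> (e0, c) \in coloring p ->
     (forall e d, (e, d) \in coloring p -> F c e != d) -> ~ mono_copy H p) ->
  builder_wins H n.
Proof.
move=> e02 Fe0 nocopy.
(* Histories are chronological, so in a play following [sigma] the head [r] is the round of [e0]. *)
pose sigma (h : seq (round n)) := if h is r :: _ then
  let e := new_edge h in (e, Some (F (paint r) e)) else (e0, Some f0).
exists sigma; split=> [[|r h] _|[|r p] lp cp bp].
- by [].
- exact: new_edgeP.
- by move/forallP/(_ e0): cp; rewrite e02.
have [er fr] := bp [::] r p erefl.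
have {}lp' := lp; case/andP: lp' => _ /allP ap.
apply: (nocopy _ (paint r)) => //; first by rewrite /= er inE eqxx.
move=> e d /mapP[s sp [-> ->]]; have /andP[_] := ap s sp.
suff -> : forbidden s = Some (F (paint r) (edge s)).
  by apply: contraNneq => ->.
move: sp; rewrite inE => /orP[/eqP->|/splitPr sp]; first by rewrite er Fe0.
by case: sp bp => h t /(_ (r :: h) s t erefl) [-> ->].
Qed.

Lemma connected_neighbor (H : sgraph) (x : H) :
  connected_graph H -> 1 < #|H| -> exists y, adj x y.
Proof.
case=> _ conn H1.
have [y] : exists y, y \in [set~ x].
  by apply/card_gt0P; rewrite cardsC1; lia.
rewrite !inE => yx; case/connectP: (conn x y) => [[|z q]] /=.
  by move=> _ xy; rewrite xy eqxx in yx.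
by case/andP => xz _ _; exists z.
Qed.

Definition covers (H : sgraph) (a b : H) : Prop :=
  forall x y, adj x y -> (x \in [:: a; b]) || (y \in [:: a; b]).

Lemma covers_dominate (H : sgraph) (a b x : H) :
  connected_graph H -> 1 < #|H| -> covers a b -> x \notin [:: a; b] ->
  adj x a || adj x b.
Proof.
move=> conn H1 cov xN; have [y xy] := connected_neighbor x conn H1.
have := cov x y xy; rewrite (negPf xN) /= !inE => /orP[] /eqP <-; by rewrite xy ?orbT.
Qed.

(* The three colors sum to 0 modulo 3, and 2 = -1. *)
Definition third (a b : color) : color :=
  @Ordinal 3 (2 * (a + b) %% 3) (ltn_pmod _ (isT : 0 < 3)).

Lemma thirdP (a b : color) : a != b ->
  third a b != b /\ forall c, [|| c == a, c == b | c == third a b].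
Proof.
rewrite -!(inj_eq val_inj) /= => ab; split=> [|c]; rewrite -?(inj_eq val_inj) /=.
  by move: (ltn_ord a) (ltn_ord b); lia.
by move: (ltn_ord a) (ltn_ord b) (ltn_ord c); lia.
Qed.

Lemma copy_bij (H : sgraph) n (phi : H -> 'I_n) :
  #|H| = n -> injective phi -> bijective phi.
Proof. by move=> Hn /inj_card_bij; apply; rewrite card_ord Hn. Qed.

Lemma builder_wins_no_cover (H : sgraph) :
  connected_graph H -> 1 < #|H| -> (forall a b : H, ~ covers a b) ->
  builder_wins H #|H|.
Proof.
move=> conn H1 nocov; have H0 := ltnW H1.
pose v := Ordinal H0; pose w := Ordinal H1.
pose red : color := ord0.
pose F c (e : {set 'I_#|H|}) :=
  if v \in e then red else if w \in e then third red c else c.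
apply: (@builder_wins_pattern _ _ [set v; w] F red).
- by rewrite cards2.
- by move=> c; rewrite /F !inE eqxx.
move=> p c lp vw_c avoid [d [phi [phi_inj copy]]].
have rc : red != c by have := avoid _ _ vw_c; rewrite /F !inE eqxx.
have [third_c /(_ d) d_cases] := thirdP rc.
have [psi phiK psiK] := copy_bij erefl phi_inj.
(* The copy spans the board and [H] has no isolated vertex, so no board vertex is isolated in color
   [d]. *)
have nbr z : exists y, ([set z; y], d) \in coloring p.
  have [y] := connected_neighbor (psi z) conn H1.
  by move/copy; rewrite psiK; exists (phi y).
case/or3P: d_cases => /eqP d_eq.
- have [y vy] := nbr v; have := avoid _ _ vy.
  by rewrite /F !inE eqxx d_eq eqxx.
- apply: (nocov (psi v) (psi w)) => x y /copy xy.
  have := avoid _ _ xy; rewrite /F d_eq !inE.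
  rewrite ![v == _]eq_sym ![w == _]eq_sym !(can2_eq phiK psiK).
  by case: (x == psi v); case: (y == psi v); case: (x == psi w);
    case: (y == psi w) => //=; rewrite eqxx.
- have [y wy] := nbr w; have := avoid _ _ wy.
  (* If [y] is [v], then [F] forbids red instead of [d], but that edge was already painted [c]. *)
  rewrite /F !inE eqxx d_eq; case: (v =P y) => [vy|_]; last by rewrite /= eqxx.
  move: wy; rewrite -vy setUC => /(coloring_fun lp vw_c) cd.
  by rewrite -d_eq -cd eqxx in third_c.
Qed.

(* Every residue modulo 15 is a difference of two elements of each class. *)
Definition class15 (x : nat) : color :=
  if x \in [:: 0; 1; 2; 3; 7] then @Ordinal 3 0 isT
  else if x \in [:: 4; 5; 8; 10; 11] then @Ordinal 3 1 isT
  else @Ordinal 3 2 isT.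

(** Modulo 15, [r - s] is a difference [u - u'] of elements of class [c], and [x = u - r] works. All
    cases are checked by computation. *)
Lemma class15_common (r s : nat) (c : color) : r < 15 -> s < 15 ->
  exists2 x, x < 15 &
    class15 ((x + r) %% 15) = c /\ class15 ((x + s) %% 15) = c.
Proof.
move=> hr hs.
have : all (fun r => all (fun s => all (fun c : nat => has (fun x =>
    (class15 ((x + r) %% 15) == c :> nat) && (class15 ((x + s) %% 15) == c :> nat))
    (iota 0 15)) (iota 0 3)) (iota 0 15)) (iota 0 15) by vm_compute.
move=> /allP/(_ r); rewrite mem_iota => /(_ hr) /allP/(_ s).
rewrite mem_iota => /(_ hs) /allP/(_ (val c)); rewrite mem_iota => /(_ (ltn_ord c)).
case/hasP => x; rewrite mem_iota => hx /andP[/eqP xr /eqP xs].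
by exists x => //; split; apply: val_inj.
Qed.

Definition edge_class n (e : {set 'I_n}) : color :=
  class15 ((\sum_(i in e) i) %% 15).

Lemma edge_class_common n (a b : 'I_n) (c : color) : 45 <= n ->
  exists z, [/\ z \notin [:: a; b], edge_class [set z; a] = c
              & edge_class [set z; b] = c].
Proof.
move=> n45; have [//|//|x x15 [xa xb]] :=
  @class15_common (a %% 15) (b %% 15) c (ltn_pmod _ _) (ltn_pmod _ _).
have [z zn [zx za zb]] : exists2 z, z < n &
    [/\ z = x %[mod 15], z != a & z != b].
  (* Of three vertices congruent to [x], one differs from both [a] and [b]; all three are below
     45. *)
  have : [|| (x != a) && (x != b), (x + 15 != a) && (x + 15 != b)
           | (x + 30 != a) && (x + 30 != b)] by lia.
  by case/or3P => /andP[za zb];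
    [exists x|exists (x + 15)|exists (x + 30)]; first [lia|split=> //; lia].
have class_z (y : 'I_n) : z != y ->
    edge_class [set Ordinal zn; y] = class15 ((x + y %% 15) %% 15).
  move=> zy; rewrite /edge_class big_setU1 ?inE //= big_set1.
  by rewrite -modnDml zx modnDml modnDmr.
by exists (Ordinal zn); rewrite !inE negb_or !class_z // za zb.
Qed.

Lemma builder_wins_cover (H : sgraph) (a b : H) :
  connected_graph H -> 45 <= #|H| -> covers a b -> builder_wins H #|H|.
Proof.
move=> conn H45 cov; have H1 : 1 < #|H| by apply: leq_trans H45.
(* The pattern ignores Painter's answer, so the choice of first edge is arbitrary. *)
pose e0 : {set 'I_#|H|} := [set Ordinal (ltnW H1); Ordinal H1].
apply: (@builder_wins_pattern _ _ e0 (fun _ => @edge_class _) (edge_class e0)) => //.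
  by rewrite cards2.
move=> p _ _ _ avoid [c [phi [phi_inj copy]]].
have [psi phiK psiK] := copy_bij erefl phi_inj.
have [z [zN za zb]] := edge_class_common (phi a) (phi b) c H45.
have : psi z \notin [:: a; b].
  by move: zN; rewrite !inE !(can2_eq psiK phiK).
case/(covers_dominate conn H1 cov)/orP => /copy; rewrite psiK => /avoid.
- by rewrite za eqxx.
- by rewrite zb eqxx.
Qed.

Theorem lemma1p4 :
  exists n0 : nat, forall n : nat, n0 <= n ->
    forall H : sgraph, #|H| = n -> connected_graph H ->
      n < turnaround_number H /\ builder_wins H n.
Proof.
exists 45 => n n45 H Hn conn; rewrite -{}Hn in n45 *.
have bw : builder_wins H #|H|.
  have [[a [b cov]]|nocov] := pselect (exists a b : H, covers a b).
    exact: builder_wins_cover cov.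
  apply: builder_wins_no_cover => //; first exact: leq_trans n45.
  by move=> a b cov; apply: nocov; exists a, b.
by split=> //; apply: builder_wins_turnaround.
Qed.
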